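(* Let $q\ge1$ and let $(G_n)_{n\ge1}$ be finite connected vertex-transitive $(q+1)$-regular graphs with $|V(G_n)|\to\infty$. Suppose the empirical spectral measures $\mu_n=\frac{1}{|V(G_n)|}\sum_{\lambda\in\mathrm{Spec}(\mathbf P(G_n))}\delta_\lambda$ (eigenvalues with multiplicity) converge weakly to a probability measure $\mu_P$ on $[-1,1]$. Then for every real $t$ with $|t|<1/(q+1)$, \[ \lim_{n\to\infty}\zeta_a(G_n,t)^{-1}=(1-t^2)^{q-1}\exp\Big[\int\log\big\{(1+qt^2)^2-(q+1)^2t^2\lambda^2\big\}\,d\mu_P(\lambda)\Big]. \]
   Context: $\mathbf P(G)$ is the transition matrix of simple random walk on $G$ ($P_{uv}=1/\deg u$ if $uv\in E(G)$, else $0$). $\zeta_a(G,t)=\exp\big(\sum_{k\ge1}\frac{N^{0,a}_k}{k}t^k\big)$ is the generalized alternating zeta function, where $N^{0,a}_k$ is the number of reduced $x_0$-alternating cycles of length $k$ in the symmetric digraph $D_G$ of $G$ for a fixed vertex $x_0$. Here $D_G$ has arcs $(u,v),(v,u)$ for each edge $uv$; an alternating walk of length $r$ is an arc sequence $[e_1,\dots,e_r]$ with vertices $v_0,\dots,v_r$ such that either $e_i=(v_{i-1},v_i)$ for odd $i$ and $e_i=(v_i,v_{i-1})$ for even $i$, or $e_i=(v_i,v_{i-1})$ for odd $i$ and $e_i=(v_{i-1},v_i)$ for even $i$; an $x_0$-alternating cycle is one of even length with $v_0=v_r=x_0$; it is reduced if $e_{i+1}\ne e_i$ for all $i\le r-1$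 and $e_r\ne e_1$. *)

(* Defs.v *)
From HB Require Import structures.
From mathcomp Require Import all_boot all_order all_algebra.
From mathcomp Require Import all_classical all_reals all_analysis.
From mathcomp Require Import fingroup perm.
Set Implicit Arguments. Unset Strict Implicit. Unset Printing Implicit Defensive.
Import Order.TTheory GRing.Theory Num.Theory.
Import numFieldNormedType.Exports.
Local Open Scope ring_scope.

Section Graphs.
Variable V : finType.
Variable e : rel V.

Definition simple_graph : Prop := symmetric e /\ irreflexive e.

Definition connected_graph : Prop := forall x y : V, connect e x y.

Definition vertex_transitive : Prop :=
  forall x y : V, exists p : {perm V},
    (forall a b, e (p a) (p b) = e a b) /\ p x = y.

Definition deg (u : V) : nat := #|[set v | e u v]|.

Definition regular (d : nat) : Prop := forall u : V, deg u = d.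

Definition transition_mx (R : fieldType) : 'M[R]_#|V| :=
  \matrix_(i, j) (if e (enum_val i) (enum_val j)
                  then ((deg (enum_val i))%:R)^-1 else 0).

Definition is_arc (a : V * V) : bool := e a.1 a.2.

(* es = [e_1; ...; e_k] (0-based index i stands for e_{i+1}),
   vs = (v_0, ..., v_k).  b = false: e_i = (v_{i-1}, v_i) for odd (paper) i,
   e_i = (v_i, v_{i-1}) for even i; b = true: the other pattern. *)
Definition alt_pattern (k : nat) (es : k.-tuple (V * V))
  (vs : {ffun 'I_k.+1 -> V}) (b : bool) : bool :=
  [forall i : 'I_k,
     tnth es i == (if odd i (+) b
                   then (vs (lift ord0 i), vs (widen_ord (leqnSn k) i))
                   else (vs (widen_ord (leqnSn k) i), vs (lift ord0 i)))].

Definition alt_cycle (x0 : V) (k : nat) (es : k.-tuple (V * V)) : bool :=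
  all is_arc es && ~~ odd k &&
  [exists vs : {ffun 'I_k.+1 -> V},
     [&& vs ord0 == x0, vs ord_max == x0 &
         alt_pattern es vs false || alt_pattern es vs true]].

Definition reduced (s : seq (V * V)) : bool :=
  if s is a :: s' then path (fun x y => x != y) a s' && (last a s' != a)
  else true.

Definition N_alt (x0 : V) (k : nat) : nat :=
  #|[set es : k.-tuple (V * V) | alt_cycle x0 es && reduced es]|.

Definition zeta_alt (R : realType) (x0 : V) (t : R) : R :=
  expR (limn (fun n => \sum_(1 <= k < n) ((N_alt x0 k)%:R / k%:R * t ^+ k))).

End Graphs.

(* Main.v *)
Require Import Defs.
From HB Require Import structures.
From mathcomp Require Import all_boot all_order all_algebra.
From mathcomp Require Import all_classical all_reals all_analysis.
From mathcomp Require Import fingroup perm measurable_realfun ring lra.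
From mathcomp Require spectral complex.
Import Order.TTheory GRing.Theory Num.Theory.
Import numFieldNormedType.Exports.
Local Open Scope ring_scope.

Set Implicit Arguments.
Unset Strict Implicit.
Unset Printing Implicit Defensive.

(** Reversing every second arc turns a reduced alternating cycle at [x0] into a
    cyclically nonbacktracking closed walk at [x0], in one of two ways according
    to the orientation pattern; so the alternating count is twice the count of
    such walks in even length and zero in odd length.  By vertex-transitivity
    the number of these walks is [\tr (B ^+ k) / #|V|], where [B = T *m S - J] is the
    nonbacktracking matrix on arcs ([S], [T] the tail and head incidence
    matrices, [J] the reversal of arcs).  The relations [S *m T = A],
    [S *m J *m T = (q + 1)%:M] and [J *m J = 1%:M] give
    [\tr (B ^+ k) = \tr (D_k(A)) + (q - 1) #|V| [k even]], with [D_k] the Dickson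
    polynomial [D_k(y + q / y) = y ^ k + (q / y) ^ k].  Since the sum of
    [D_k(x) t ^ k / k] is [- ln (1 - x t + q t ^ 2)], the zeta function is the
    exponential of an average of a continuous bounded function over the spectrum,
    and weak convergence concludes. *)

(** * Dickson polynomials of a matrix and its spectrum *)

(* Dickson polynomials at [x]: [u = 2] gives the first kind, [u = 1] the second.
   The lock keeps rewriting lemmas from unfolding [dickson u a x k.+2]. *)
HB.lock Definition dickson (S : pzRingType) (u a x : S) (k : nat) : S :=
  (iter k (fun p => (p.2, x * p.2 - a * p.1)) (u, x)).1.

Lemma nat_ind2 (P : nat -> Prop) :
  P 0 -> P 1 -> (forall k, P k -> P k.+1 -> P k.+2) -> forall k, P k.
Proof.
move=> P0 P1 PS k; suff [] : P k /\ P k.+1 by [].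
by elim: k => [//|k [Pk Pk1]]; split => //; apply: PS.
Qed.

Lemma dickson0 (S : pzRingType) (u a x : S) : dickson u a x 0 = u.
Proof. by rewrite dickson.unlock. Qed.

Lemma dickson1 (S : pzRingType) (u a x : S) : dickson u a x 1 = x.
Proof. by rewrite dickson.unlock. Qed.

Lemma dicksonSS (S : pzRingType) (u a x : S) k :
  dickson u a x k.+2 = x * dickson u a x k.+1 - a * dickson u a x k.
Proof. by rewrite dickson.unlock. Qed.

Lemma rmorph_dickson (S S' : pzRingType) (f : {rmorphism S -> S'}) u a x k :
  f (dickson u a x k) = dickson (f u) (f a) (f x) k.
Proof.
elim/nat_ind2: k => [||k IH0 IH1]; rewrite ?dickson0 ?dickson1 //.
by rewrite !dicksonSS rmorphB !rmorphM IH0 IH1.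
Qed.

Lemma conj_dickson (F : fieldType) n (P A : 'M[F]_n) (u a : F) k :
  P \in unitmx ->
  P *m dickson u%:M a%:M A k *m invmx P
  = dickson u%:M a%:M (P *m A *m invmx P) k.
Proof.
move=> Pu; have Ps (c : F) B : P *m (c%:M *m B) *m invmx P = c%:M *m (P *m B *m invmx P).
  by rewrite !mul_scalar_mx -scalemxAr -scalemxAl.
elim/nat_ind2: k => [||k IH0 IH1]; rewrite ?dickson0 ?dickson1 //.
  by rewrite scalar_mxC -mulmxA mulmxV // mulmx1.
rewrite !dicksonSS -!mulmxE -IH0 -IH1 -Ps.
rewrite mulmxBr mulmxBl; congr (_ - _).
by rewrite !mulmxA mulmxKV.
Qed.

Lemma trig_mulmx (F : fieldType) n (A B : 'M[F]_n) :
  is_trig_mx A -> is_trig_mx B ->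
  is_trig_mx (A *m B) /\ forall i, (A *m B) i i = A i i * B i i.
Proof.
move=> /is_trig_mxP tA /is_trig_mxP tB; split.
  apply/is_trig_mxP => i j ij; rewrite mxE big1 // => l _.
  have [il|li] := ltnP i l; first by rewrite tA // mul0r.
  by rewrite tB ?mulr0 //; exact: leq_ltn_trans li ij.
move=> i; rewrite mxE (bigD1 i) //= big1 ?addr0 // => l li.
have [il|il] := ltnP i l; first by rewrite tA // mul0r.
by rewrite tB ?mulr0 // ltn_neqAle il andbT.
Qed.

Lemma trig_dickson (F : fieldType) n (A : 'M[F]_n) (u a : F) k :
  is_trig_mx A ->
  is_trig_mx (dickson u%:M a%:M A k) /\
  forall i, dickson u%:M a%:M A k i i = dickson u a (A i i) k.
Proof.
move=> tA; elim/nat_ind2: k => [||k [t0 d0] [t1 d1]].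
- split=> [|i]; rewrite !dickson0; first exact: scalar_mx_is_trig.
  by rewrite mxE eqxx.
- by split=> [|i]; rewrite !dickson1.
have [t2 d2] := trig_mulmx tA t1.
have [t3 d3] := trig_mulmx (scalar_mx_is_trig n a) t0.
split=> [|i]; rewrite !dicksonSS -!mulmxE.
  apply/is_trig_mxP => i j ij; rewrite !mxE.
  move/is_trig_mxP: t2 => /(_ i j ij); rewrite mxE => ->.
  by move/is_trig_mxP: t3 => /(_ i j ij); rewrite mxE => ->; rewrite subr0.
by rewrite mxE d2 [X in _ + X]mxE d3 d0 d1 mxE eqxx.
Qed.

Lemma char_poly_conj (F : fieldType) n (P A : 'M[F]_n) :
  P \in unitmx -> char_poly (P *m A *m invmx P) = char_poly A.
Proof.
move=> Pu; rewrite /char_poly.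
have -> : char_poly_mx (P *m A *m invmx P)
    = map_mx polyC P *m char_poly_mx A *m map_mx polyC (invmx P).
  rewrite /char_poly_mx mulmxBr mulmxBl !map_mxM; congr (_ - _).
  by rewrite scalar_mxC -mulmxA -map_mxM mulmxV // map_mx1 mulmx1.
rewrite !det_mulmx mulrC mulrA -det_mulmx -map_mxM mulVmx //.
by rewrite map_mx1 det1 mul1r.
Qed.

Section TraceDickson.
Import complex.

(** Over [R[i]] the matrix has a Schur triangular form. A Dickson polynomial of a triangular matrix
    acts entrywise on the diagonal, and unique factorization of the characteristic polynomial
    identifies the diagonal of [D] with [s] up to order. The scalar [c] is there to pass from
    transition to adjacency matrices. *)
Lemma trace_dickson_spec (R : rcfType) n (P : 'M[R]_n) (s : seq R) (u a c : R) k :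
  char_poly P = \prod_(x <- s) ('X - x%:P) ->
  \tr (dickson u%:M a%:M (c *: P) k) = \sum_(x <- s) dickson u a (c * x) k.
Proof.
(* The Schur form requires a positive size. *)
case: n P => [|n] P hP.
  rewrite /mxtrace big_ord0; suff -> : s = [::] by rewrite big_nil.
  have := size_char_poly P; rewrite hP size_prod_XsubC => -[].
  by case: s {hP}.
pose f : {rmorphism R -> R[i]} := real_complex R.
pose Pf := map_mx f P.
have [Q Qu] := @spectral.Schur _ _ Pf isT.
have {}Qu := spectral.unitarymx_unit Qu.
rewrite /mxred.similar_to /mxred.conjmx pinvmxE // => tD.
set D := Q *m Pf *m invmx Q in tD.
have : perm_eq [seq f x | x <- s] [seq D i i | i <- enum 'I_n.+1].
  apply: prod_XsubC_eq; rewrite 2!big_map enumT -[RHS]char_poly_trig //.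
  rewrite char_poly_conj // -map_char_poly hP rmorph_prod.
  by apply: eq_bigr => x _; rewrite rmorphB /= map_polyX map_polyC.
move=> sD.
have finj : injective f by exact: fmorph_inj.
apply: finj; transitivity (\tr (map_mx f (dickson u%:M a%:M (c *: P) k))).
  by rewrite trace_map_mx.
rewrite [in RHS]rmorph_sum.
have -> : map_mx f (dickson u%:M a%:M (c *: P) k) = dickson (f u)%:M (f a)%:M (f c *: Pf) k.
  by rewrite (rmorph_dickson (map_mx f)) /= !map_scalar_mx map_mxZ.
have -> : \tr (dickson (f u)%:M (f a)%:M (f c *: Pf) k) =
          \tr (dickson (f u)%:M (f a)%:M (f c *: D) k).
  rewrite /D scalemxAl scalemxAr -conj_dickson //.
  by rewrite mxtrace_mulC mulmxA mulVmx // mul1mx.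
have tcD : is_trig_mx (f c *: D).
  apply/is_trig_mxP => i j ij; rewrite mxE.
  by move/is_trig_mxP: tD => ->; rewrite ?mulr0.
have [_ dD] := trig_dickson (f u) (f a) k tcD.
rewrite /mxtrace (eq_bigr (fun i => dickson (f u) (f a) (f c * D i i) k)); last first.
  by move=> i _; rewrite dD mxE.
rewrite -big_enum -(big_map (fun i => D i i) xpredT (fun y => dickson (f u) (f a) (f c * y) k)).
rewrite -(perm_big _ sD) big_map /=; apply: eq_bigr => x _.
by rewrite (rmorph_dickson f) rmorphM.
Qed.
End TraceDickson.

(** * Matrices indexed by finite types *)

Definition fmx (R : pzRingType) (I J : finType) (f : I -> J -> R) : 'M[R]_(#|I|, #|J|) :=
  \matrix_(i, j) f (enum_val i) (enum_val j).

Lemma eq_fmx (R : pzRingType) (I J : finType) (f g : I -> J -> R) :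
  (forall i j, f i j = g i j) -> fmx f = fmx g.
Proof. by move=> fg; apply/matrixP => i j; rewrite !mxE fg. Qed.

Lemma fmxM (R : pzRingType) (I J K : finType) (f : I -> J -> R) (g : J -> K -> R) :
  fmx f *m fmx g = fmx (fun i k => \sum_j f i j * g j k).
Proof.
apply/matrixP => i k; rewrite !mxE.
rewrite (reindex (@enum_val J predT)) /=; last exact/onW_bij/enum_val_bij.
by apply: eq_bigr => j _; rewrite !mxE.
Qed.

Lemma fmx1 (R : pzRingType) (I : finType) : fmx (fun i j : I => (i == j)%:R : R) = 1%:M.
Proof. by apply/matrixP => i j; rewrite !mxE (inj_eq enum_val_inj). Qed.

Lemma trace_fmx (R : pzRingType) (I : finType) (f : I -> I -> R) :
  \tr (fmx f) = \sum_i f i i.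
Proof.
rewrite /mxtrace [RHS](reindex (@enum_val I predT)) /=; last exact/onW_bij/enum_val_bij.
by apply: eq_bigr => j _; rewrite !mxE.
Qed.

Lemma sum_indic (R : pzRingType) (I : finType) (a : I) (f : I -> R) :
  \sum_i (i == a)%:R * f i = f a.
Proof.
rewrite (bigD1 a) //= eqxx mul1r big1 ?addr0 // => i /negPf ->.
by rewrite mul0r.
Qed.

(** * Trace formula for the nonbacktracking matrix *)

Lemma dickson_first_second (S : pzRingType) (a x : S) k : a * x = x * a ->
  dickson 2 a x k.+1 = dickson 1 a x k.+1 *+ 2 - x * dickson 1 a x k.
Proof.
move=> ax; elim/nat_ind2: k => [||k IH0 IH1].
- by rewrite dickson0 !dickson1 mulr1 mulr2n addrK.
- by rewrite !dicksonSS !dickson0 !dickson1 !mulr1 mulr_natr mulrnBl [x * x *+ 2]mulr2n addrAC addrK.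
rewrite [LHS]dicksonSS IH0 IH1.
rewrite [in RHS](dicksonSS 1 a x k) (dicksonSS 1 a x k.+1).
rewrite !mulrBr mulrnBl !mulrnAr !opprB addrACA [in RHS]addrACA; congr (_ + _).
  by rewrite !mulrA ax.
by rewrite addrC.
Qed.

Section NonBacktracking.
Variables (R : comPzRingType) (n m : nat) (q : R).
Variables (A : 'M[R]_n) (S : 'M[R]_(n, m)) (T : 'M[R]_(m, n)) (J : 'M[R]_m).
Hypothesis ST : S *m T = A.
Hypothesis SJT : S *m J *m T = (q + 1)%:M.
Hypothesis JJ : J *m J = 1%:M.
Let B := T *m S - J.
Let X k := dickson 1%:M q%:M A k.

(** With [nb_SJB], this shows that right multiplication by [B] preserves the combinations
    [Y *m S + Z *m (S *m J)] and acts on [(Y, Z)] by the companion form of the Dickson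
    recurrence. *)
Lemma nb_SB : S *m B = A *m S - S *m J.
Proof. by rewrite mulmxBr mulmxA ST. Qed.

Lemma nb_SJB : S *m J *m B = q *: S.
Proof.
rewrite mulmxBr mulmxA SJT -mulmxA JJ mulmx1 mul_scalar_mx scalerDl scale1r.
by rewrite addrK.
Qed.

Lemma dickson_comm u k : A * dickson u%:M q%:M A k = dickson u%:M q%:M A k * A.
Proof.
elim/nat_ind2: k => [||k IH0 IH1]; rewrite ?dickson0 ?dickson1 //.
  by rewrite -!mulmxE scalar_mxC.
rewrite !dicksonSS mulrBr mulrBl -mulrA IH1; congr (_ - _).
by rewrite -mulrA -IH0 !mulrA -!mulmxE scalar_mxC.
Qed.

Lemma nb_SBk k : S *m B ^+ k.+1 = X k.+1 *m S - X k *m (S *m J).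
Proof.
elim: k => [|k IH]; first by rewrite expr1 nb_SB /X dickson0 dickson1 mul1mx.
rewrite exprSr -mulmxE mulmxA IH mulmxBl -2!mulmxA nb_SB nb_SJB.
rewrite mulmxBr mulmxA /X [dickson _ _ _ k.+2]dicksonSS dickson_comm mulmxBl.
rewrite -!mulmxE mul_scalar_mx -scalemxAr -scalemxAl.
by rewrite addrAC.
Qed.

(** Peeling off two factors [T *m S - J] returns to [B ^+ k.+1] because [J] is an involution.
    Cyclicity of the trace brings the remaining terms to the form treated by [nb_SBk]. *)
Lemma nb_trace_step k : \tr (B ^+ k.+3) - \tr (B ^+ k.+1) =
  \tr (X k.+2 *m A) - (2 * (q + 1)) * \tr (X k.+1) + \tr (X k *m A).
Proof.
have swap (U : 'M[R]_(m, n)) (Y : 'M[R]_m) : \tr (U *m S *m Y) = \tr (S *m Y *m U).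
  by rewrite -[in LHS]mulmxA [LHS]mxtrace_mulC.
have e1 : \tr (B ^+ k.+3) = \tr (S *m B ^+ k.+2 *m T) - \tr (J *m B ^+ k.+2).
  by rewrite [B ^+ k.+3]exprS -mulmxE {1}/B mulmxBl raddfB /= swap.
have e2 : \tr (J *m B ^+ k.+2) = \tr (S *m B ^+ k.+1 *m (J *m T)) - \tr (B ^+ k.+1).
  rewrite [B ^+ k.+2]exprS -mulmxE mulmxA {1}/B mulmxBr JJ mulmxBl mul1mx raddfB /=.
  by rewrite [J *m (T *m S)]mulmxA swap.
rewrite e1 e2 !nb_SBk !(mulmxBl (X _ *m S)).
have ->: X k.+2 *m S *m T = X k.+2 *m A by rewrite -mulmxA ST.
have -> j : X j *m (S *m J) *m T = (q + 1) *: X j.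
  by rewrite -mulmxA SJT scalar_mxC mul_scalar_mx.
have -> j : X j *m S *m (J *m T) = (q + 1) *: X j.
  by rewrite -mulmxA [S *m _]mulmxA SJT scalar_mxC mul_scalar_mx.
have -> j : X j *m (S *m J) *m (J *m T) = X j *m A.
  by rewrite -!mulmxA [J *m (J *m T)]mulmxA JJ mul1mx ST.
rewrite !raddfB /= !mxtraceZ; ring.
Qed.


Hypothesis trJ : \tr J = 0.

(** The recursion advances by two, so the correction depends only on parity. It is read off from the
    exponents 1, where [\tr J = 0], and 2. *)
Lemma nb_trace k : \tr (B ^+ k.+1) =
  \tr (dickson 2%:M q%:M A k.+1) + (m%:R - 2 * n%:R) *+ odd k.
Proof.
have M2 : 2%:M = 2 :> 'M[R]_n by rewrite raddfMn.
elim/nat_ind2: k => [||k IH0 _].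
- by rewrite expr1 {1}/B raddfB /= trJ mulr0n addr0 subr0 mxtrace_mulC ST dickson1.
- rewrite dicksonSS dickson0 dickson1 expr2 -mulmxE {1}/B mulmxBl raddfB /= -mulmxA mxtrace_mulC nb_SB.
  rewrite mulmxBl SJT -mulmxA ST {1}/B mulmxBr JJ mulmxA !raddfB /= -!mulmxE.
  rewrite [\tr (J *m T *m S)]mxtrace_mulC mulmxA SJT mul_scalar_mx.
  rewrite mxtraceZ !mxtrace_scalar mulr1n -[(q + 1) *+ n]mulr_natr -[2 *+ n]mulr_natr; ring.
- rewrite -[LHS](subrK (\tr (B ^+ k.+1))) nb_trace_step IH0 /= negbK addrA; congr (_ + _).
  (* First-kind traces are expressed through the second kind [X]; expanding [X k.+3] once makes both
     sides linear in the same three traces. *)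
  rewrite M2 !dickson_first_second; try exact/esym/scalar_mxC.
  have -> : dickson 1 q%:M A = X by [].
  have -> : X k.+3 = A *m X k.+2 - q *: X k.+1 by rewrite /X dicksonSS -!mulmxE mul_scalar_mx.
  rewrite -!mulmxE !raddfB /= !raddfMn /= !raddfB /= mxtraceZ.
  rewrite (mxtrace_mulC (X k)) (mxtrace_mulC (X k.+2)); ring.
Qed.
End NonBacktracking.

(** * Cyclic sequences and traces of matrix powers *)

Lemma cycle_nthP (T : Type) (r : rel T) (x : T) (s : seq T) :
  (forall i, (i < size s)%N -> r (nth x s i) (nth x s (i.+1 %% size s))) <-> path.cycle r s.
Proof.
case: s => [//|a s]; rewrite [size _]/= [path.cycle _ _]/=.
have E i : (i < (size s).+1)%N ->
    nth x (rcons s a) i = nth x (a :: s) (i.+1 %% (size s).+1).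
  rewrite ltnS leq_eqVlt nth_rcons => /orP[/eqP ->|lt].
    by rewrite ltnn eqxx modnn.
  by rewrite lt modn_small.
have E' i : (i < (size s).+1)%N -> nth x (a :: rcons s a) i = nth x (a :: s) i.
  by rewrite -rcons_cons nth_rcons /= => ->.
split=> [H|/(pathP x) H i lt].
  by apply/(pathP x) => i; rewrite size_rcons => lt; rewrite E' // E //; apply: H.
by have := H i; rewrite size_rcons => /(_ lt); rewrite E' // E.
Qed.

Lemma trace_fmx_expr (R : pzRingType) (I : finType) (r : rel I) k :
  \tr (fmx (fun a b => (r a b)%:R : R) ^+ k.+1)
  = #|[set s : k.+1.-tuple I | path.cycle r s]|%:R.
Proof.
(* The starting point [a] is not in the tuple, so a walk of [j] steps is a [j]-tuple. *)
have pathM j : fmx (fun a b => (r a b)%:R : R) ^+ j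
    = fmx (fun a b => #|[set s : j.-tuple I | path r a s && (last a s == b)]|%:R).
  elim: j => [|j IH].
    rewrite expr0 -[LHS]fmx1; apply: eq_fmx => a b; congr (_%:R).
    have [->|ab] := eqVneq a b.
      apply/esym/eqP/cards1P; exists [tuple]; apply/setP => s.
      by rewrite !inE (tuple0 s) /= !eqxx.
    by apply/esym/eqP; rewrite cards_eq0; apply/eqP/setP => s; rewrite !inE (tuple0 s) /= (negPf ab).
  rewrite exprS IH -mulmxE fmxM; apply: eq_fmx => a b.
  under eq_bigr do rewrite -natrM.
  rewrite -natr_sum; congr (_%:R).
  rewrite -sum1_card (partition_big (fun s : j.+1.-tuple I => thead s) predT) //=.
  apply: eq_bigr => c _; rewrite sum1_card.
  rewrite -(@card_imset _ _ (fun s : j.-tuple I => [tuple of c :: s])); last first.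
    by move=> s t /(congr1 val) [] st; exact: val_inj.
  case rac : (r a c); rewrite ?mul1n ?mul0n.
    apply: eq_card => s; rewrite [RHS]unfold_in; apply/imsetP/andP.
      by case=> t; rewrite inE => /andP[pt lt] ->; rewrite inE /= rac pt lt theadE.
    case/tupleP: s => d s; rewrite inE /= theadE => -[/andP[/andP[_ ps] ls] /eqP dc].
    subst d; exists s; rewrite ?inE ?ps //.
  apply/esym/eq_card0 => s; rewrite unfold_in inE; case/tupleP: s => d s /=; rewrite theadE.
  by apply/negbTE/negP => /andP[/andP[/andP[rad _] _] /eqP dc]; rewrite -dc rad in rac.
rewrite pathM trace_fmx -natr_sum; congr (_%:R).
(* A cyclic sequence is a walk starting at its own last entry; grouping by that entry gives the
   diagonal. *)
rewrite -[RHS]sum1_card (partition_big (fun s : k.+1.-tuple I => last (thead s) s) predT) //=.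
apply: eq_bigr => a _; rewrite sum1_card; apply: eq_card => s; rewrite [RHS]unfold_in !inE.
case/tupleP: s => c s; rewrite (cycle_path a) /=.
by case: eqVneq => [->|]; rewrite ?andbT ?andbF.
Qed.

(** * Nonbacktracking cycles of arcs *)

Definition swap {V : Type} (a : V * V) := (a.2, a.1).

Lemma swapK (V : Type) : involutive (@swap V).
Proof. by case. Qed.

Definition nbstep {V : eqType} (a b : V * V) := (a.2 == b.1) && (a.1 != b.2).

Section Arcs.
Variables (V : finType) (e : rel V).
Hypothesis esym : symmetric e.
Hypothesis eirr : irreflexive e.

Local Notation arc := {a : V * V | is_arc e a}.

(** [path.cycle] also forbids backtracking from the last arc to the first. The default [(x, x)] only
    concerns the empty tuple. *)
Definition nb_cycles (x : V) k : {set k.-tuple (V * V)} :=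
  [set s : k.-tuple (V * V) | [&& all (is_arc e) s, path.cycle nbstep s & (head (x, x) s).1 == x]].

Lemma arc_swap a : is_arc e (swap a) = is_arc e a.
Proof. exact: esym. Qed.

Lemma big_arc (R : nmodType) (F : V * V -> R) :
  \sum_(a : arc) F (val a) = \sum_u \sum_v (F (u, v)) *+ e u v.
Proof.
rewrite pair_bigA /= (eq_bigr (fun p => if is_arc e p then F p else 0)); last first.
  by move=> [u v] _ /=; rewrite /is_arc /=; case: (e u v).
rewrite -big_mkcond /= [RHS](reindex_omap (val : arc -> V * V) insub) /=.
  by apply: eq_bigl => a; rewrite (valP a) valK eqxx.
by move=> p hp; rewrite insubT.
Qed.

Lemma card_arcs q : regular e q -> #|{: arc}| = (#|V| * q)%N.
Proof.
move=> reg; rewrite card_sig -sum1_card.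
rewrite -(pair_big_dep xpredT e (fun _ _ => 1%N)) /= -sum_nat_const.
by apply: eq_bigr => u _; rewrite -(reg u) /deg -sum1dep_card.
Qed.

Section Matrices.
Variable R : comPzRingType.

Definition adj_mx : 'M[R]_#|V| := fmx (fun u v => (e u v)%:R).
Let S : 'M[R]_(#|V|, #|{: arc}|) := fmx (fun u (a : arc) => (u == (val a).1)%:R).
Let T : 'M[R]_(#|{: arc}|, #|V|) := fmx (fun (a : arc) v => (v == (val a).2)%:R).
Let J : 'M[R]_#|{: arc}| := fmx (fun a b : arc => (val b == swap (val a))%:R).

Lemma arc_ST : S *m T = adj_mx.
Proof.
rewrite fmxM; apply: eq_fmx => u v.
rewrite (big_arc (fun a => (u == a.1)%:R * (v == a.2)%:R)) /=.
rewrite (bigD1 u) //= eqxx [X in _ + X]big1 ?addr0; last first.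
  by move=> w wu; apply: big1 => z _; rewrite eq_sym (negPf wu) mul0r mul0rn.
rewrite (bigD1 v) //= eqxx big1 ?addr0 ?mul1r //.
by move=> w wu; rewrite eq_sym (negPf wu) mulr0 mul0rn.
Qed.

Lemma swap_arc_subproof (a : arc) : is_arc e (swap (val a)).
Proof. by rewrite arc_swap (valP a). Qed.

Definition swap_arc (a : arc) : arc := Sub (swap (val a)) (swap_arc_subproof a).


Lemma arc_JM (K : finType) (f : arc -> K -> R) :
  J *m fmx f = fmx (fun a k => f (swap_arc a) k).
Proof.
rewrite fmxM; apply: eq_fmx => a k.
rewrite -[RHS](sum_indic (swap_arc a) (f^~ k)); apply: eq_bigr => b _.
by rewrite -val_eqE.
Qed.

Lemma arc_JJ : J *m J = 1%:M.
Proof.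
rewrite arc_JM -fmx1; apply: eq_fmx => a b /=.
by rewrite swapK val_eqE eq_sym.
Qed.

Lemma arc_SJT q : regular e q -> S *m J *m T = q%:R%:M.
Proof.
move=> reg; rewrite -mulmxA arc_JM fmxM.
apply/matrixP => i j; rewrite !mxE /=.
rewrite (big_arc (fun a => (enum_val i == a.1)%:R * (enum_val j == a.1)%:R)) /=.
rewrite (bigD1 (enum_val i)) //= eqxx mul1r [X in _ + X]big1 ?addr0; last first.
  by move=> w wu; apply: big1 => z _; rewrite eq_sym (negPf wu) mul0r mul0rn.
rewrite (inj_eq enum_val_inj) sumrMnr eq_sym; case: eqVneq => _; rewrite ?mul0rn //.
rewrite mulr1n; congr (_%:R); rewrite -(reg (enum_val i)) /deg -sum1dep_card [RHS]big_mkcond.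
by apply: eq_bigr => v _; case: (e _ v).
Qed.

Lemma arc_trJ : \tr J = 0.
Proof.
rewrite trace_fmx big1 // => a _; case: a => -[u v] /= uv.
by rewrite /swap /= xpair_eqE; case: eqVneq uv => // ->; rewrite /is_arc /= eirr.
Qed.

(** The product detects head-to-tail contiguity. An arc is always contiguous with its reversal, so
    subtracting [J] removes exactly the backtracking steps. *)
Lemma arc_B : T *m S - J = fmx (fun a b : arc => (nbstep (val a) (val b))%:R).
Proof.
rewrite fmxM; apply/matrixP => i j; rewrite !mxE.
move: (enum_val i) (enum_val j) => [[u v] uv] [[w z] wz] /=.
rewrite sum_indic /nbstep /swap /= xpair_eqE (eq_sym w) (eq_sym z).
by case: (v == w); case: (u == z); rewrite /= ?subr0 ?subrr.
Qed.

(** Each cyclic sequence counted by the trace is sorted by the tail of its first arc. *)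
Lemma sum_card_nb_cycles q k : regular e q.+1 ->
  (\sum_x #|nb_cycles x k.+1|)%:R =
  \tr (dickson 2%:M q%:R%:M adj_mx k.+1) + ((q%:R - 1) * #|V|%:R) *+ odd k :> R.
Proof.
move=> reg.
have SJT : S *m J *m T = (q%:R + 1)%:M by rewrite natr1 (arc_SJT reg).
have := nb_trace arc_ST SJT arc_JJ arc_trJ k.
rewrite arc_B trace_fmx_expr (card_arcs reg).
have -> : (#|V| * q.+1)%:R - 2 * #|V|%:R = (q%:R - 1) * #|V|%:R :> R.
  rewrite natrM -natr1; ring.
move=> <-; congr (_%:R).
rewrite -[RHS](@card_imset _ _ (map_tuple val)); last first.
  by move=> s t /(congr1 val) /(inj_map val_inj) st; exact: val_inj.
rewrite -[RHS]sum1_card (partition_big (fun s : k.+1.-tuple (V * V) => (thead s).1) predT) //=.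
apply: eq_bigr => x _; rewrite sum1_card; apply: eq_card => s; rewrite [RHS]unfold_in inE.
have -> : head (x, x) s = thead s by case/tupleP: s => a s; rewrite theadE.
rewrite andbA; congr (_ && _); apply/andP/imsetP => [[al cy]|[t]]; last first.
  rewrite inE => ct ->; split; last by rewrite /= path.cycle_map.
  by apply/allP => _ /mapP[a _ ->]; exact: valP.
have hd : is_arc e (thead s) by move/all_tnthP: al; apply.
(* The default of [insubd] is never reached: every entry of [s] is an arc. *)
set t := map_tuple (insubd (Sub (thead s) hd : arc)) s.
have st : s = map_tuple val t.
  apply: val_inj => /=; rewrite -map_comp -[LHS]map_id; apply/eq_in_map => a.
  by move/(allP al) => ha /=; rewrite insubdK.
exists t => //; rewrite inE.
by move: cy; rewrite {1}st /= path.cycle_map.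
Qed.

End Matrices.

(** An automorphism maps cycles injectively. One inequality suffices, since transitivity supplies
    automorphisms in both directions. *)
Lemma leq_card_nb_cycles (p : {perm V}) x k : (forall a b, e (p a) (p b) = e a b) ->
  (#|nb_cycles x k.+1| <= #|nb_cycles (p x) k.+1|)%N.
Proof.
move=> hp; pose g (a : V * V) := (p a.1, p a.2).
have ginj : injective g by move=> [a b] [c d] [/perm_inj -> /perm_inj ->].
rewrite -(card_imset _ (_ : injective (map_tuple g : k.+1.-tuple _ -> k.+1.-tuple _))); last first.
  by move=> s t /(congr1 val) /(inj_map ginj) st; exact: val_inj.
apply/subset_leq_card/fintype.subsetP => _ /imsetP[s + ->]; rewrite !inE /= => /and3P[al cy hd].
apply/and3P; split.
- by apply/allP => _ /mapP[a /(allP al) + ->]; rewrite /is_arc hp.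
- rewrite path.cycle_map; move: cy; congr is_true; apply: eq_cycle => a b.
  by rewrite /nbstep /= !(inj_eq perm_inj).
- by case/tupleP: s hd {al cy} => a s /= /eqP ->.
Qed.

Lemma card_nb_cycles_transitive x y k : vertex_transitive e ->
  #|nb_cycles x k.+1| = #|nb_cycles y k.+1|.
Proof.
move=> vt; apply/eqP; rewrite eqn_leq; apply/andP; split.
  by have [p [hp <-]] := vt x y; exact: leq_card_nb_cycles.
by have [p [hp <-]] := vt y x; exact: leq_card_nb_cycles.
Qed.

(** * From alternating cycles to nonbacktracking cycles *)

Definition alternate k (b : bool) (s : k.-tuple (V * V)) : k.-tuple (V * V) :=
  [tuple (if odd i (+) b then swap (tnth s i) else tnth s i) | i < k].

Lemma alternateK k b : involutive (@alternate k b).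
Proof.
move=> s; apply: eq_from_tnth => i; rewrite !tnth_mktuple.
by case: (odd i (+) b); rewrite ?swapK.
Qed.

Lemma reduced_cycle (s : seq (V * V)) : reduced s = path.cycle (fun x y => x != y) s.
Proof. by case: s => [//|a s] /=; rewrite rcons_path. Qed.

(** Exactly one of two consecutive arcs gets reversed, so equality of neighbours in [es] becomes
    backtracking in [alternate b es], and the alternating pattern becomes head-to-tail
    contiguity. *)
Lemma alternate_nb_cycles x k b (es : k.+1.-tuple (V * V)) : odd k ->
  (alternate b es \in nb_cycles x k.+1) =
  [&& all (is_arc e) es, reduced es &
      [exists vs : {ffun 'I_k.+2 -> V},
        [&& vs ord0 == x, vs ord_max == x & alt_pattern es vs b]]].
Proof.
move=> ok; set f := alternate _ _; rewrite inE.
have fE i : (i < k.+1)%N -> nth (x, x) f i =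
    if odd i (+) b then swap (nth (x, x) es i) else nth (x, x) es i.
  move=> lt; have := tnth_mktuple (fun i => if odd i (+) b then swap (tnth es i) else tnth es i) (Ordinal lt).
  by rewrite !(tnth_nth (x, x)).
have -> : all (is_arc e) f = all (is_arc e) es.
  apply/all_tnthP/all_tnthP => H i; have := H i; rewrite tnth_mktuple;
    by case: ifP; rewrite ?arc_swap.
congr (_ && _); rewrite reduced_cycle -nth0.
(* The length [k.+1] is even, so parity also alternates across the wrap-around. *)
have modE i : (i < k.+1)%N -> odd (i.+1 %% k.+1) = ~~ odd i.
  by move=> _; rewrite odd_mod //= ok.
have neqE i : (i < k.+1)%N ->
    (nth (x, x) es i != nth (x, x) es (i.+1 %% k.+1)) =
    (nth (x, x) f i != swap (nth (x, x) f (i.+1 %% k.+1))).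
  move=> lt; rewrite !fE ?ltn_pmod // modE //.
  by case: (odd i); case: b {f fE}; rewrite /= ?swapK // (inj_eq (inv_inj (@swapK V))).
have eqs (a c : V * V) : a.2 = c.1 -> (a != swap c) = (a.1 != c.2).
  by move: a c => [a a'] [c c'] /= <-; rewrite xpair_eqE eqxx andbT.
apply/andP/andP => [[/cycle_nthP cy /eqP hd]|[/cycle_nthP red /existsP[vs /and3P[/eqP v0 /eqP vk /forallP pat]]]].
  have {}cy i : (i < k.+1)%N -> nbstep (nth (x, x) f i) (nth (x, x) f (i.+1 %% k.+1)).
    by move=> lt; have := cy (x, x) i; rewrite size_tuple; apply.
  split.
    apply/(cycle_nthP _ (x, x)) => i; rewrite size_tuple => lt; rewrite neqE //.
    by have /andP[/eqP h1 h2] := cy i lt; rewrite eqs.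
  (* The vertices are the tails of the arcs; reducing the index modulo the length closes the
     sequence at [x]. *)
  pose v i := (nth (x, x) f (i %% k.+1)).1.
  have fv i : (i < k.+1)%N -> nth (x, x) f i = (v i, v i.+1).
    move=> lt; have /andP[/eqP h1 h2] := cy i lt.
    by rewrite /v modn_small // -h1; case: nth.
  apply/existsP; exists [ffun i : 'I_k.+2 => v i]; rewrite !ffunE /v /= mod0n modnn hd eqxx /=.
  apply/forallP => i; rewrite !ffunE (tnth_nth (x, x)) /=.
  have := fv i (ltn_ord i); rewrite fE // /bump /= add1n.
  by case: ifP => _ h; apply/eqP; rewrite -?h //; rewrite -[LHS]swapK h.
pose v i := vs (inord i).
have fv i : (i < k.+1)%N -> nth (x, x) f i = (v i, v i.+1).
  move=> lt; rewrite fE //; have /eqP := pat (Ordinal lt).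
  rewrite (tnth_nth (x, x)) /= /v.
  have -> : widen_ord (leqnSn k.+1) (Ordinal lt) = inord i.
    by apply: val_inj; rewrite /= inordK // ltnW.
  have -> : lift ord0 (Ordinal lt) = inord i.+1.
    by apply: val_inj; rewrite /= inordK.
  by case: ifP => _ ->.
have v0' : v 0 = x by rewrite -v0 /v; congr (vs _); apply: val_inj; rewrite /= inordK.
have vk' : v k.+1 = x by rewrite -vk /v; congr (vs _); apply: val_inj; rewrite /= inordK.
(* The wrap-around case holds because both ends of the vertex sequence are [x]. *)
have chain i : (i < k.+1)%N -> (nth (x, x) f i).2 = (nth (x, x) f (i.+1 %% k.+1)).1.
  move=> lt; rewrite !fv ?ltn_pmod //=.
  move: lt; rewrite ltnS leq_eqVlt => /orP[/eqP ->|lt]; first by rewrite modnn v0' vk'.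
  by rewrite modn_small.
split; last by rewrite fv //= v0'.
apply/(cycle_nthP _ (x, x)) => i; rewrite size_tuple => lt.
rewrite /nbstep chain // eqxx /= -eqs ?chain // -neqE //.
by have := red (x, x) i; rewrite size_tuple; apply.
Qed.

(** Each of the two patterns contributes one copy of the nonbacktracking cycles, through an
    involution, and the copies are disjoint. *)
Lemma N_altE x k : N_alt e x k.+1 = (if odd k then 2 * #|nb_cycles x k.+1| else 0)%N.
Proof.
rewrite /N_alt; case: ifP => ok; last first.
  by apply: eq_card0 => s; rewrite !inE /alt_cycle /= ok andbF.
have E b : #|[set es | alternate b es \in nb_cycles x k.+1]| = #|nb_cycles x k.+1|.
  rewrite -[RHS](card_imset _ (inv_inj (@alternateK k.+1 b))).
  apply: eq_card => s; rewrite inE; apply/idP/imsetP => [h|[t ht ->]].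
    by exists (alternate b s) => //; rewrite alternateK.
  by rewrite alternateK.
rewrite mul2n -addnn -{1}(E false) -(E true) -cardsUI.
(* A tuple following both patterns would have a loop at [x] as its first arc. *)
rewrite [X in (_ = _ + X)%N](_ : _ = 0%N) ?addn0; last first.
  have hd (f : k.+1.-tuple (V * V)) : head (x, x) f = tnth f ord0 by case/tupleP: f.
  apply: eq_card0 => s; rewrite !inE !hd !tnth_mktuple /=.
  apply/negP => /andP[/and3P[al _ /eqP h0] /and3P[_ _ /eqP h1]].
  have := allP al _ (mem_tnth ord0 (alternate false s)).
  rewrite tnth_mktuple /= /is_arc h0.
  by have -> : (tnth s ord0).2 = x by []; rewrite eirr.
have -> : [set es : k.+1.-tuple (V * V) | alt_cycle e x es && reduced es] =
    [set es | alternate false es \in nb_cycles x k.+1] :|: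
    [set es | alternate true es \in nb_cycles x k.+1]; last by [].
apply/setP => s; rewrite finset.in_setU inE [in RHS]inE [X in _ || X]inE !alternate_nb_cycles //.
rewrite /alt_cycle /= ok /= andbT.
set E0 := [exists vs, _]; set E1 := [exists vs, _]; set E2 := [exists vs, _].
have -> : E0 = E1 || E2.
  apply/existsP/orP => [[vs /and3P[v0 vk /orP[h|h]]]|[]/existsP[vs /and3P[v0 vk h]]].
  - by left; apply/existsP; exists vs; rewrite v0 vk.
  - by right; apply/existsP; exists vs; rewrite v0 vk.
  - by exists vs; rewrite v0 vk h.
  - by exists vs; rewrite v0 vk h orbT.
by rewrite -!andb_orr [_ && reduced _]andbAC -andbA.
Qed.
End Arcs.

(** * Bounds on eigenvalues and Dickson polynomials *)

Lemma eigenvalue_norm_le1 (R : realFieldType) n (M : 'M[R]_n) (c : R) :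
  (forall i, \sum_j `|M i j| <= 1) -> eigenvalue M c -> `|c| <= 1.
Proof.
move=> hM /eigenvalueP[v vM v0].
(* Eigenvectors are row vectors here, so bounded row sums contract the l1 norm. *)
have vpos : 0 < \sum_j `|v 0 j|.
  rewrite lt_neqAle sumr_ge0 ?andbT; last by move=> *; exact: normr_ge0.
  apply: contra_neq v0 => /esym/eqP; rewrite psumr_eq0 => [/allP h|j _]; last exact: normr_ge0.
  apply/rowP => j; rewrite mxE; apply/eqP; rewrite -normr_eq0.
  by have := h j; rewrite mem_index_enum => /(_ isT).
rewrite -(ler_pM2r vpos) mul1r mulr_sumr.
apply: (@le_trans _ _ (\sum_j \sum_i `|v 0 i| * `|M i j|)).
  apply: ler_sum => j _; rewrite -normrM.
  have -> : c * v 0 j = \sum_i v 0 i * M i j.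
    by move/rowP/(_ j): vM; rewrite !mxE.
  by apply: le_trans (ler_norm_sum _ _ _) _; apply: ler_sum => i _; rewrite normrM.
rewrite exchange_big; apply: ler_sum => i _ /=; rewrite -mulr_sumr.
by rewrite ler_piMr.
Qed.

(* This conserved quadratic form is definite when [x ^+ 2 < 4 * a], which bounds
   [dickson 2 a x k] without going through the complex roots. *)
Lemma dickson_energy (R : comPzRingType) (a x : R) k :
  dickson 2 a x k.+1 ^+ 2 - x * dickson 2 a x k * dickson 2 a x k.+1
    + a * dickson 2 a x k ^+ 2 = a ^+ k * (4 * a - x ^+ 2).
Proof.
elim: k => [|k IH]; first by rewrite dickson0 dickson1 expr0; ring.
rewrite dicksonSS [a ^+ k.+1]exprS -[a * _ * (4 * a - _)]mulrA -IH; ring.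
Qed.

Lemma dickson_bound (R : rcfType) (a x : R) k : 0 <= a -> `|x| <= a + 1 ->
  `|dickson 2 a x k| <= 2 * (a + 1) ^+ k.
Proof.
move=> a0 xa; have b0 : 0 <= a + 1 by lra.
have [disc|disc] := ltP (x ^+ 2) (4 * a).
  have := dickson_energy a x k.
  set D := dickson 2 a x k; set D' := dickson 2 a x k.+1 => E.
  (* Completing the square in the energy identity isolates [(4 * a - x ^+ 2) * D ^+ 2 / 4]. *)
  have h : D ^+ 2 <= 4 * a ^+ k.
    rewrite -(ler_pM2r (_ : 0 < 4 * a - x ^+ 2)) ?subr_gt0 // -[4 * _ * _]mulrA -E.
    have := sqr_ge0 (D' - x * D / 2); nra.
  rewrite -ler_sqr ?nnegrE ?mulr_ge0 ?exprn_ge0 // real_normK ?num_real //.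
  apply: (le_trans h); rewrite exprMn -exprM mulnC exprM.
  rewrite (_ : 2 ^+ 2 = 4 :> R); last by ring.
  rewrite ler_pM2l //; apply: lerXn2r; rewrite ?nnegrE ?exprn_ge0 //.
  nra.
(* In the remaining case the roots [(x + s) / 2] and [(x - s) / 2] of [y ^+ 2 - x * y + a] are real,
   and at most [|x|] in absolute value. *)
set s := Num.sqrt (x ^+ 2 - 4 * a).
have s2 : s ^+ 2 = x ^+ 2 - 4 * a by rewrite sqr_sqrtr // subr_ge0.
have sx : `|s| <= `|x|.
  by rewrite -ler_sqr ?nnegrE // !real_normK ?num_real // s2; lra.
have -> : dickson 2 a x k = ((x + s) / 2) ^+ k + ((x - s) / 2) ^+ k.
  elim/nat_ind2: k => [||k IH0 IH1]; first by rewrite dickson0 !expr0; ring.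
    by rewrite dickson1 !expr1; field.
  rewrite dicksonSS IH0 IH1 !exprS.
  have -> : a = (x ^+ 2 - s ^+ 2) / 4 by rewrite s2; field.
  by field.
have bnd z : `|z| <= `|x| -> `|(x + z) / 2| <= a + 1.
  move=> zx; have := ler_normD x z; rewrite normrM [`|2^-1|]ger0_norm //; lra.
apply: (le_trans (ler_normD _ _)); rewrite !normrX mulr_natl mulr2n.
by apply: lerD; apply: lerXn2r; rewrite ?nnegrE // bnd // normrN.
Qed.

(** The quadratic is at least [(1 - v) * (1 - a * v)] at [v = |u|], and this polynomial decreases on
    [[0, |t|]]. *)
Lemma quadratic_lower_bound (R : realFieldType) (a x t u : R) :
  0 <= a -> `|x| <= a + 1 -> `|u| <= `|t| -> `|t| < (a + 1)^-1 ->
  (1 - `|t|) * (1 - a * `|t|) <= 1 - x * u + a * u ^+ 2.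
Proof.
move=> a0 xa ut ta.
have : `|t| * (a + 1) < 1 by rewrite -ltr_pdivlMr ?mul1r //; lra.
have := normr_ge0 u; have := normr_ge0 t.
have : x * u <= (a + 1) * `|u|.
  by apply: le_trans (ler_norm _) _; rewrite normrM ler_wpM2r.
rewrite -(real_normK (num_real u)).
move: `|u| `|t| ut => v w vw xv w0 v0 aw.
(* This product is the difference of the values of that polynomial at [v] and at [w]. *)
have : 0 <= (w - v) * ((a + 1) - a * (w + v)) by apply: mulr_ge0; nra.
nra.
Qed.

(** As [x - 2 * a * u] is minus the derivative of the quadratic factor, the sum approximates minus
    its logarithmic derivative, with an explicit remainder. *)
Lemma dickson_generating (R : comPzRingType) (a x u : R) m :
  (1 - x * u + a * u ^+ 2) * \sum_(k < m) dickson 2 a x k.+1 * u ^+ k =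
  (x - 2 * a * u) - u ^+ m * (dickson 2 a x m.+1 - a * u * dickson 2 a x m).
Proof.
elim: m => [|m IH]; first by rewrite big_ord0 dickson0 dickson1 expr0; ring.
rewrite big_ord_recr /= mulrDr IH dicksonSS [u ^+ m.+1]exprS; ring.
Qed.

(** * Logarithmic series of Dickson polynomials *)

Local Open Scope classical_set_scope.

(** The error [F m] vanishes at 0 and its derivative is geometrically small in [m], so the mean
    value theorem makes it tend to 0 at [t]. *)
Lemma ln_dickson_series (R : realType) (a x t : R) :
  0 <= a -> `|x| <= a + 1 -> `|t| < (a + 1)^-1 ->
  (fun n => \sum_(1 <= k < n) (dickson 2 a x k / k%:R * t ^+ k)) @ \oo -->
    - ln (1 - x * t + a * t ^+ 2).
Proof.
move=> a0 xa ta.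
have ta1 : `|t| * (a + 1) < 1 by rewrite -ltr_pdivlMr ?mul1r //; lra.
have t0 := normr_ge0 t.
pose d := (1 - `|t|) * (1 - a * `|t|).
have d0 : 0 < d by apply: mulr_gt0; nra.
pose p : {poly R} := 1 - x *: 'X + a *: 'X^2.
have pE u : p.[u] = 1 - x * u + a * u ^+ 2 by rewrite !hornerE.
have dp u : (deriv p).[u] = - x + 2 * a * u.
  rewrite /p !poly.derivE !hornerE; ring.
have pd u : `|u| <= `|t| -> d <= p.[u].
  by move=> ut; rewrite pE; exact: quadratic_lower_bound.
pose P m : {poly R} := \sum_(k < m) (dickson 2 a x k.+1 / k.+1%:R) *: 'X^(k.+1).
pose F m (u : R) := ln p.[u] + (P m).[u].
have PE m : deriv (P m) = \sum_(k < m) dickson 2 a x k.+1 *: 'X^k.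
  rewrite raddf_sum /=; apply: eq_bigr => k _.
  by rewrite derivZ derivXn -['X^_ *+ _]scaler_nat scalerA divfK ?pnatr_eq0.
(* By [dickson_generating], only a boundary term of size [(|t| (a + 1)) ^ m]
   survives in the derivative of [F m]. *)
pose dF m (u : R) := - (u ^+ m * (dickson 2 a x m.+1 - a * u * dickson 2 a x m)) / p.[u].
have F' m (u : R) : `|u| <= `|t| -> is_derive u (1 : R) (F m) (dF m u).
  move=> ut; have pu : 0 < p.[u] := lt_le_trans d0 (pd u ut).
  have h1 : is_derive u (1 : R) (@ln R \o horner p) ((p.[u])^-1 * (deriv p).[u]).
    by apply: is_derive1_comp; exact: is_derive1_ln.
  have h2 : is_derive u (1 : R) (horner (P m)) (deriv (P m)).[u] by exact: is_derive_poly.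
  apply: is_derive_eq (is_deriveD h1 h2) _.
  have := dickson_generating a x u m; rewrite -pE dp PE horner_sum.
  under [in X in _ -> X]eq_bigr do rewrite !hornerE.
  move=> h; apply: (mulfI (lt0r_neq0 pu)); rewrite mulrDr h /dF.
  by field; rewrite lt0r_neq0.
(* [dickson_bound] at two consecutive indices gives the numerator, the lower bound [d] of [p] the
   denominator, and the mean value theorem the last factor [|t|]. *)
pose C := 2 * ((a + 1) + a * `|t|) / d * `|t|.
have bound m : `|F m t| <= C * (`|t| * (a + 1)) ^+ m.
  have bdF c : `|c| <= `|t| -> `|dF m c * t| <= C * (`|t| * (a + 1)) ^+ m.
    move=> ct; rewrite normrM /dF normrM normrN normrM normrX.
    have h1 : `|(p.[c])^-1| <= d^-1.
      have pc := pd c ct; rewrite ger0_norm; last by rewrite invr_ge0; lra.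
      by rewrite lef_pV2 // posrE //; lra.
    have h2 : `|dickson 2 a x m.+1 - a * c * dickson 2 a x m|
        <= 2 * ((a + 1) + a * `|t|) * (a + 1) ^+ m.
      apply: (le_trans (ler_normB _ _)).
      have k1 := dickson_bound m.+1 a0 xa; have k0 := dickson_bound m a0 xa.
      have e0 : 0 <= (a + 1) ^+ m by rewrite exprn_ge0 //; lra.
      rewrite !normrM (ger0_norm a0); rewrite exprS in k1.
      have : a * `|c| * `|dickson 2 a x m| <= a * `|t| * (2 * (a + 1) ^+ m).
        by apply: ler_pM => //; [apply: mulr_ge0|apply: ler_wpM2l].
      lra.
    have h3 : `|c| ^+ m <= `|t| ^+ m by apply: lerXn2r; rewrite ?nnegrE.
    rewrite /C exprMn.
    have -> : 2 * (a + 1 + a * `|t|) / d * `|t| * (`|t| ^+ m * (a + 1) ^+ m) =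
      `|t| ^+ m * (2 * (a + 1 + a * `|t|) * (a + 1) ^+ m) * d^-1 * `|t| by ring.
    apply: ler_wpM2r => //; apply: ler_pM => //.
    by apply: ler_pM => //; exact: exprn_ge0.
  have F0 : F m 0 = 0.
    rewrite /F pE expr0n !mulr0 subr0 addr0 ln1 add0r.
    by rewrite horner_sum big1 // => k _; rewrite !hornerE expr0n /= mulr0.
  have Fc u : `|u| <= `|t| -> {for u, continuous (F m)}.
    move=> ut; apply/differentiable_continuous/derivable1_diffP.
    by have [] := F' m u ut.
  have [tpos|tneg] := leP 0 t.
    have sub c : c \in `[0, t]%R -> `|c| <= `|t|.
      by rewrite in_itv /= => /andP[c0 ct]; rewrite !ger0_norm.
    have [||c /sub ct] := @MVT_segment R (F m) (dF m) 0 t tpos.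
    - by move=> c /subset_itv_oo_cc/sub; exact: F'.
    - apply: continuous_in_subspaceT => c /set_mem/sub; exact: Fc.
    by rewrite F0 !subr0 => ->; exact: bdF.
  have sub c : c \in `[t, 0]%R -> `|c| <= `|t|.
    by rewrite in_itv /= => /andP[c0 ct]; rewrite !ler0_norm ?lerN2 // ltW.
  have [||c /sub ct] := @MVT_segment R (F m) (dF m) t 0 (ltW tneg).
  - by move=> c /subset_itv_oo_cc/sub; exact: F'.
  - apply: continuous_in_subspaceT => c /set_mem/sub; exact: Fc.
  by rewrite F0 !sub0r => /(congr1 Num.norm); rewrite normrN => ->; rewrite mulrN normrN; exact: bdF.
have Fcvg : F ^~ t @ \oo --> 0.
  apply: norm_cvg0; apply: (@squeeze_cvgr _ _ _ _ (cst 0) (geometric C (`|t| * (a + 1)))).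
  - by near=> m; rewrite normr_ge0 /= bound.
  - exact: cvg_cst.
  - by apply: cvg_geometric; rewrite ger0_norm // mulr_ge0 //; lra.
(* The sum over [1 <= k < n] has only [n - 1] terms; the shift matches it with [P n]. *)
rewrite -cvg_shiftS /=.
have -> : (fun n => \sum_(1 <= k < n.+1) (dickson 2 a x k / k%:R * t ^+ k)) =
    (fun n => F n t - ln (1 - x * t + a * t ^+ 2)).
  apply/funext => n; rewrite /F pE addrAC subrr add0r horner_sum big_add1 big_mkord.
  by apply: eq_bigr => k _; rewrite !hornerE.
have := cvgB Fcvg (cvg_cst (ln (1 - x * t + a * t ^+ 2))).
by rewrite sub0r => lim_F; exact: lim_F.
Unshelve. all: by end_near. Qed.

(** This is the case [a = 0], [x = 1], where all Dickson terms of positive index are 1. *)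
Lemma geometric_ln_series (R : realType) (t : R) : `|t| < 1 ->
  (fun n => \sum_(1 <= k < n) (k%:R^-1 * t ^+ k)) @ \oo --> - ln (1 - t).
Proof.
move=> t1.
have D1 k : dickson 2 0 1 k.+1 = 1 :> R.
  by elim: k => [|k IH]; rewrite ?dickson1 // dicksonSS IH mul1r mul0r subr0.
have := @ln_dickson_series R 0 1 t (lexx 0).
rewrite !add0r normr1 invr1 mul1r mul0r addr0 => /(_ (lexx 1) t1).
rewrite (_ : (fun n => _) = (fun n => \sum_(1 <= k < n) (k%:R^-1 * t ^+ k))) //.
apply/funext => n; apply: eq_big_nat => -[|k] // _.
by rewrite D1 mul1r.
Qed.

(** * The zeta function as a spectral average *)

Definition alt_symbol (R : realType) (q : nat) (t x : R) : R :=
  (1 + q%:R * t ^+ 2) ^+ 2 - q.+1%:R ^+ 2 * t ^+ 2 * x ^+ 2.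

Lemma alt_symbol_factor (R : realType) (q : nat) (t x : R) :
  alt_symbol q t x = (1 - q.+1%:R * x * t + q%:R * t ^+ 2) *
                     (1 - q.+1%:R * x * - t + q%:R * (- t) ^+ 2).
Proof. rewrite /alt_symbol; ring. Qed.

Section Zeta.
Variables (R : realType) (q : nat) (V : finType) (e : rel V) (s : seq R) (x0 : V) (t : R).
Hypothesis hq : (1 <= q)%N.
Hypothesis hsimple : simple_graph e.
Hypothesis htrans : vertex_transitive e.
Hypothesis hreg : regular e q.+1.
Hypothesis hspec : char_poly (transition_mx e R) = \prod_(x <- s) ('X - x%:P).
Hypothesis ht : `|t| < (q.+1%:R)^-1.

Lemma transition_adj : adj_mx e R = q.+1%:R *: transition_mx e R.
Proof.
apply/matrixP => i j; rewrite !mxE hreg; case: ifP => _; last by rewrite mulr0.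
by rewrite mulfV // pnatr_eq0.
Qed.

Lemma spec_le1 x : x \in s -> `|x| <= 1.
Proof.
move=> xs; apply: (@eigenvalue_norm_le1 _ _ (transition_mx e R)); last first.
  by rewrite eigenvalue_root_char hspec root_prod_XsubC.
move=> i; set u := enum_val i.
have -> : \sum_j `|transition_mx e R i j| = \sum_v (if e u v then q.+1%:R^-1 else 0).
  rewrite [RHS](reindex (@enum_val V predT)) /=; last exact/onW_bij/enum_val_bij.
  apply: eq_bigr => j _; rewrite mxE hreg -/u.
  by case: ifP => _; rewrite ?normr0 // ger0_norm // invr_ge0.
rewrite -big_mkcond /= sumr_const -[_ *+ _]mulr_natr -(hreg u) /deg cardsE.
by rewrite mulVf // -cardsE; have := hreg u; rewrite /deg => ->; rewrite pnatr_eq0.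
Qed.

(** The factor 2 in even length and 0 in odd length is absorbed into the sum of the powers of [t]
    and [- t], so each sign can be summed as a logarithmic series. *)
Lemma N_alt_spec k : (N_alt e x0 k.+1)%:R * t ^+ k.+1 =
  #|V|%:R^-1 * \sum_(x <- s) (dickson 2 q%:R (q.+1%:R * x) k.+1 * t ^+ k.+1
                            + dickson 2 q%:R (q.+1%:R * x) k.+1 * (- t) ^+ k.+1)
  + (q%:R - 1) * (t ^+ k.+1 + (- t) ^+ k.+1).
Proof.
have [es ei] := hsimple.
have V0 : #|V|%:R != 0 :> R by rewrite pnatr_eq0 -lt0n; apply/card_gt0P; exists x0.
have := sum_card_nb_cycles es ei R k hreg.
rewrite transition_adj (trace_dickson_spec _ _ _ _ hspec).
rewrite (eq_bigr (fun=> #|nb_cycles e x0 k.+1|)); last first.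
  by move=> y _; exact: card_nb_cycles_transitive.
rewrite sum_nat_const natrM => H.
rewrite big_split /= -!mulr_suml -mulrDr.
rewrite (N_altE es ei); case ok : (odd k) H => /= H; last first.
  by rewrite [(- t) ^+ _]exprNn -signr_odd /= ok expr1 mulN1r subrr !mulr0 mul0r addr0.
rewrite [(- t) ^+ _]exprNn -signr_odd /= ok expr0 mul1r.
have -> : \sum_(x <- s) dickson 2 q%:R (q.+1%:R * x) k.+1 =
   #|V|%:R * #|nb_cycles e x0 k.+1|%:R - (q%:R - 1) * #|V|%:R by rewrite H mulr1n addrK.
by rewrite natrM; field.
Qed.

Lemma zeta_altE : (zeta_alt e x0 t)^-1 =
  (1 - t ^+ 2) ^+ q.-1 * expR (#|V|%:R^-1 * \sum_(x <- s) ln (alt_symbol q t x)).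
Proof.
have q1 : q%:R + 1 = q.+1%:R :> R by rewrite natr1.
have q0 : 0 <= q%:R :> R by rewrite ler0n.
have xq x : x \in s -> `|q.+1%:R * x| <= q%:R + 1.
  by move=> xs; rewrite normrM ger0_norm // q1 ler_piMr // spec_le1.
have htq : `|t| < (q%:R + 1)^-1 by rewrite q1.
have t1 : `|t| < 1.
  by apply: lt_le_trans ht _; rewrite invf_le1 // ler1n.
pose L := #|V|%:R^-1 * \sum_(x <- s) - ln (alt_symbol q t x) + (q%:R - 1) * - ln (1 - t ^+ 2).
(* Positivity of both factors lets [ln] split their product. *)
have pos x u : x \in s -> `|u| = `|t| -> 0 < 1 - q.+1%:R * x * u + q%:R * u ^+ 2.
  move=> xs ut; apply: lt_le_trans (quadratic_lower_bound q0 (xq _ xs) _ htq); last by rewrite ut.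
  have := normr_ge0 t; have : `|t| * (q%:R + 1) < 1 by rewrite -ltr_pdivlMr ?mul1r // q1.
  by move=> h1 h2; apply: mulr_gt0; nra.
have lim : (fun n => \sum_(1 <= k < n) ((N_alt e x0 k)%:R / k%:R * t ^+ k)) @ \oo --> L.
  pose D (x u : R) n := \sum_(1 <= k < n) (dickson 2 q%:R (q.+1%:R * x) k / k%:R * u ^+ k).
  pose G (u : R) n := \sum_(1 <= k < n) (k%:R^-1 * u ^+ k).
  have -> : (fun n => \sum_(1 <= k < n) ((N_alt e x0 k)%:R / k%:R * t ^+ k)) =
      (fun n => #|V|%:R^-1 * \sum_(x <- s) (D x t n + D x (- t) n)
                + (q%:R - 1) * (G t n + G (- t) n)).
    apply/funext => n.
    have -> : \sum_(x <- s) (D x t n + D x (- t) n) = \sum_(1 <= k < n) \sum_(x <- s)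
        (dickson 2 q%:R (q.+1%:R * x) k / k%:R * t ^+ k
         + dickson 2 q%:R (q.+1%:R * x) k / k%:R * (- t) ^+ k).
      by rewrite exchange_big; apply: eq_bigr => x _; rewrite big_split.
    rewrite /G -big_split /= !mulr_sumr -big_split /=.
    apply: eq_big_nat => -[//|k] _.
    rewrite mulrAC N_alt_spec mulrDl -mulrA mulr_suml; congr (_ * _ + _); last by ring.
    by apply: eq_bigr => x _; ring.
  rewrite /L; apply: cvgD.
    apply: cvgMr; under eq_cvg do rewrite big_seq_cond; rewrite [\sum_(x <- s) - ln _]big_seq_cond.
    apply: cvg_big => [|x /andP[xs _]]; first exact: add_continuous.
    have -> : - ln (alt_symbol q t x) = - ln (1 - q.+1%:R * x * t + q%:R * t ^+ 2)
        + - ln (1 - q.+1%:R * x * - t + q%:R * (- t) ^+ 2).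
      by rewrite alt_symbol_factor lnM ?posrE ?opprD // pos // normrN.
    by apply: cvgD; apply: ln_dickson_series; rewrite ?normrN // xq.
  apply: cvgMr.
  have -> : - ln (1 - t ^+ 2) = - ln (1 - t) + - ln (1 - - t).
    have := t1; rewrite ltr_norml => /andP[h1 h2].
    rewrite -opprD -lnM ?posrE; [congr (- ln _); ring|lra|lra].
  by apply: cvgD; apply: geometric_ln_series; rewrite ?normrN.
rewrite /zeta_alt (cvg_lim _ lim) // -expRN.
(* Since [1 <= q], the truncated [q.-1] is the actual [q - 1]. *)
have -> : - L = q.-1%:R * ln (1 - t ^+ 2) + #|V|%:R^-1 * \sum_(x <- s) ln (alt_symbol q t x).
  by rewrite /L sumrN !mulrN -opprD opprK addrC -[q in q%:R](prednK hq) -natr1 addrK.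
rewrite expRD expRM_natl lnK // posrE subr_gt0 -real_normK ?num_real //.
by rewrite expr_lt1.
Qed.
End Zeta.

(** * A bounded continuous test function *)

Section Clipping.
Variables (R : realType) (q : nat) (t : R).
Hypothesis ht : `|t| < (q.+1%:R)^-1.

(* The symbol may be negative outside [-1, 1]; clipping it from below makes its
   logarithm an admissible test function for weak convergence. *)
Definition ln_clip (x : R) : R :=
  ln (Num.max (alt_symbol q t x) (alt_symbol q t 1)).

(** The symbol is nonincreasing in [x ^+ 2], so its value at 1 is its minimum over [-1, 1], which is
    the clipping level. *)
Lemma alt_symbol1_gt0 : 0 < alt_symbol q t 1.
Proof.
have q0 : 0 <= q%:R :> R by [].
have htq : `|t| < (q%:R + 1)^-1 by rewrite natr1.
have b : `|q.+1%:R * 1 : R| <= q%:R + 1 by rewrite mulr1 ger0_norm // natr1.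
have d0 : 0 < (1 - `|t|) * (1 - q%:R * `|t|).
  have := normr_ge0 t; have : `|t| * (q%:R + 1) < 1 by rewrite -ltr_pdivlMr ?mul1r // natr1.
  by move=> h1 h2; apply: mulr_gt0; nra.
rewrite alt_symbol_factor; apply: mulr_gt0; apply: lt_le_trans d0 _.
  exact: quadratic_lower_bound.
by apply: quadratic_lower_bound => //; rewrite normrN.
Qed.

Lemma ln_clipE x : `|x| <= 1 -> ln_clip x = ln (alt_symbol q t x).
Proof.
move=> x1; rewrite /ln_clip max_l // /alt_symbol lerD2l lerN2.
apply: ler_wpM2l; first by apply: mulr_ge0; exact: sqr_ge0.
by rewrite expr1n -(real_normK (num_real x)) expr_le1.
Qed.

Lemma continuous_ln_clip : continuous ln_clip.
Proof.
move=> x; rewrite /ln_clip.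
apply: (@continuous_cvg _ _ _ _ _ (fun x => Num.max (alt_symbol q t x) (alt_symbol q t 1)) (@ln R)).
  by apply: continuous_ln; rewrite lt_max alt_symbol1_gt0 orbT.
apply: continuous_max; last exact: cvg_cst.
rewrite /alt_symbol; apply: cvgB; first exact: cvg_cst.
apply: cvgMr; exact: exprn_continuous.
Qed.

Lemma measurable_ln_clip : measurable_fun setT ln_clip.
Proof. exact: (continuous_measurable_fun continuous_ln_clip). Qed.

Lemma measurable_ln_alt_symbol :
  measurable_fun setT (fun x => ln (alt_symbol q t x)).
Proof.
apply: (measurableT_comp (@measurable_ln R)); apply: continuous_measurable_fun => x.
by apply: cvgB; [exact: cvg_cst|apply: cvgMr; exact: exprn_continuous].
Qed.

Lemma ln_clip_bounded : exists M, forall x, `|ln_clip x| <= M.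
Proof.
have d0 := alt_symbol1_gt0.
(* Clipping bounds the argument below; dropping the term in [x ^+ 2] bounds it above. *)
exists (Num.max (- ln (alt_symbol q t 1)) (ln ((1 + q%:R * t ^+ 2) ^+ 2))) => x.
have bd y : alt_symbol q t y <= (1 + q%:R * t ^+ 2) ^+ 2.
  by rewrite /alt_symbol gerBl; apply: mulr_ge0; [apply: mulr_ge0|]; exact: sqr_ge0.
have g0 : 0 < (1 + q%:R * t ^+ 2) ^+ 2 := lt_le_trans d0 (bd 1).
rewrite ler_norml le_max; apply/andP; split.
  rewrite lerNl le_max lerN2 ler_ln ?posrE ?le_max ?lexx ?orbT //.
  by rewrite lt_max d0 orbT.
by apply/orP; right; rewrite ler_ln ?posrE ?ge_max ?bd // lt_max d0 orbT.
Qed.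

(** The two integrands can differ only outside [-1, 1], a null set of [mu]. *)
Lemma integral_ln_clip (mu : probability R R) : mu `[-1, 1] = 1%E ->
  (\int[mu]_x (ln_clip x)%:E = \int[mu]_x (ln (alt_symbol q t x))%:E)%E.
Proof.
move=> mu1; apply: ae_eq_integral => //.
- apply/measurable_EFinP; exact: measurable_ln_clip.
- apply/measurable_EFinP; exact: measurable_ln_alt_symbol.
- exists (~` `[-1, 1]); split => //.
  + exact: measurableC.
  + by rewrite [LHS]probability_setC // mu1 subee.
  move=> x /= h xI; apply: h => _; congr (_%:E); apply: ln_clipE.
  by move: xI; rewrite in_itv /= ler_norml.
Qed.

Lemma integral_ln_clip_fin_num (mu : probability R R) :
  (\int[mu]_x (ln_clip x)%:E)%E \is a fin_num.
Proof.
apply: integrable_fin_num => //; apply: measurable_bounded_integrable => //.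
- by rewrite [X in (X < _)%E]probability_setT ltry.
- exact: measurable_ln_clip.
have [M hM] := ln_clip_bounded.
by exists M; split; [exact: num_real|move=> y My x _ /=; apply: le_trans (hM x) (ltW My)].
Qed.

End Clipping.

(** * Passage to the limit along the graphs *)

Unset Implicit Arguments.

Theorem theorem10 (R : realType) (q : nat) (hq : (1 <= q)%N)
  (V : nat -> finType) (e : forall n, rel (V n))
  (hsimple : forall n, simple_graph (e n))
  (hconn : forall n, connected_graph (e n))
  (htrans : forall n, vertex_transitive (e n))
  (hreg : forall n, regular (e n) q.+1)
  (hsize : forall M : nat, exists N : nat, forall n, (N <= n)%N -> (M <= #|V n|)%N)
  (* spec n : the eigenvalues of P(G_n), listed with (algebraic) multiplicity *)
  (spec : nat -> seq R)
  (hspec : forall n, char_poly (transition_mx (e n) R)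
                     = \prod_(x <- spec n) ('X - x%:P))
  (muP : probability R R)
  (hsupp : muP `[-1, 1] = 1%E)
  (hweak : forall f : R -> R, continuous f -> (exists M, forall x, `|f x| <= M) ->
     (fun n => ((#|V n|%:R)^-1 * \sum_(x <- spec n) f x)%:E) @ \oo
       --> (\int[muP]_x (f x)%:E)%E)
  (x0 : forall n, V n)
  (t : R) (ht : `|t| < (q.+1%:R)^-1) :
  (fun n => (zeta_alt (e n) (x0 n) t)^-1) @ \oo -->
    (1 - t ^+ 2) ^+ (q.-1) *
    expR (fine (\int[muP]_x
                  (ln ((1 + q%:R * t ^+ 2) ^+ 2
                       - (q.+1%:R) ^+ 2 * t ^+ 2 * x ^+ 2))%:E)%E).
Proof.
have lim := hweak _ (continuous_ln_clip ht) (ln_clip_bounded ht).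
have fin := integral_ln_clip_fin_num ht muP.
(* The integral is finite, so the convergence descends from the extended reals to [R]. *)
rewrite -(fineK fin) in lim; move/fine_cvg: lim; rewrite (integral_ln_clip ht) // => lim.
have -> : (fun n => (zeta_alt (e n) (x0 n) t)^-1) =
    (fun n => (1 - t ^+ 2) ^+ q.-1 *
       expR (#|V n|%:R^-1 * \sum_(x <- spec n) ln_clip q t x)).
  apply/funext => n.
  rewrite (zeta_altE _ hq (hsimple n) (htrans n) (hreg n) (hspec n) ht).
  congr (_ * expR (_ * _)); apply: eq_big_seq => x xs.
  (* Eigenvalues lie in [-1, 1], where clipping changes nothing. *)
  by rewrite ln_clipE // (spec_le1 (hreg n) (hspec n)).
apply: cvgMr; exact: (continuous_cvg _ (@continuous_expR R _) lim).
Qed.
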